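(* Let $(X,\tau)$ and $(Y,\zeta)$ be topological spaces, let $\mathcal{F}$ be a rough family on $X$ and $\mathcal{L}$ a rough family on $Y$, and let $\mathcal{F}^{\#}=\{\{x\}:x\in X\}$ and $\mathcal{L}^{\#}=\{\{y\}:y\in Y\}$ be the singleton rough families on $X$ and $Y$. Then every $(\mathcal{F},\mathcal{L}^{\#})$-continuous map $f:X\to Y$ is continuous. Moreover, every continuous map $g:X\to Y$ is $(\mathcal{F}^{\#},\mathcal{L})$-continuous.
   Context: A rough family on a set $X$ is an indexed family $\mathcal{F}=\{F_x : x\in X\}$ of subsets of $X$ with $x\in F_x$ for all $x\in X$. For a topological space $(X,\tau)$ with rough family $\mathcal{F}$ and $A\subset X$, the rough interior is $A^{o\mathcal{F}}=\{x\in A:\text{ there is a }\tau\text{-open set }U\text{ with }F_x\subset U\subset A\}$, and $A$ is called $\mathcal{F}$-open if $A^{o\mathcal{F}}=A$. Given rough families $\mathcal{F}$ on $(X,\tau)$ and $\mathcal{L}$ on $(Y,\zeta)$, a map $f:X\to Y$ is $(\mathcal{F},\mathcal{L})$-continuous if $f^{-1}(V)$ is $\mathcal{F}$-open in $X$ for every $\mathcal{L}$-open set $V$ in $Y$. *)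

(* Defs.v *)
From mathcomp Require Import all_boot all_classical topology.

Set Implicit Arguments.
Unset Strict Implicit.
Unset Printing Implicit Defensive.

Local Open Scope classical_set_scope.

Record rough_family (X : Type) := RoughFamily {
  rough_set :> X -> set X;
  rough_mem : forall x, rough_set x x
}.

Definition singleton_family (X : Type) : rough_family X :=
  @RoughFamily X (fun x => [set x]) (fun x => erefl x).

Definition rough_interior (X : topologicalType) (F : rough_family X)
    (A : set X) : set X :=
  [set x | A x /\ exists U : set X, [/\ open U, F x `<=` U & U `<=` A]].

Definition rough_open (X : topologicalType) (F : rough_family X)
    (A : set X) : Prop :=
  rough_interior F A = A.

Definition rough_continuous (X Y : topologicalType) (F : rough_family X)
    (L : rough_family Y) (f : X -> Y) : Prop :=
  forall V : set Y, rough_open L V -> rough_open F (f @^-1` V).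

(* Main.v *)
Require Import Defs.
From mathcomp Require Import all_boot all_classical topology.

(** Rough openness with respect to any family is at least as strong as
    openness ([open_of_rough_open]): since [F x] contains [x], an open [U]
    with [F x] inside [U] and [U] inside [A] is a neighbourhood of [x] inside
    [A].  For the singleton family the converse holds as well
    ([rough_open_singleton]), as [A] itself can serve as [U] at each of its
    points.  Both claims then follow by taking a preimage:
    on the side carrying the singleton family an open set may be exchanged for
    a rough-open one by the second fact, and on the other side only the
    implication from rough openness to openness is called for. *)

Local Open Scope classical_set_scope.

(** The membership axiom [x \in F x] is what makes the open set witnessing
    roughness at [x] a neighbourhood of [x]. *)
Lemma open_of_rough_open (X : topologicalType) (F : rough_family X)
    (A : set X) : rough_open F A -> open A.
Proof.
move=> FA; rewrite openE => x Ax.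
move: Ax; rewrite -{1}FA => -[_ [U [Uo FxU UA]]].
apply: (filterS UA); apply: open_nbhs_nbhs; split => //.
exact/FxU/rough_mem.
Qed.

Lemma rough_open_singleton (X : topologicalType) (A : set X) :
  open A -> rough_open (singleton_family X) A.
Proof.
move=> Ao; apply/seteqP; split => [x []//|x Ax].
by split=> //; exists A; split=> // _ ->.
Qed.

Theorem theorem3p1 (X Y : topologicalType) (F : rough_family X)
    (L : rough_family Y) :
  (forall f : X -> Y,
     rough_continuous F (singleton_family Y) f -> continuous f) /\
  (forall g : X -> Y,
     continuous g -> rough_continuous (singleton_family X) L g).
Proof.
split=> [f fc|g /continuousP gc V LV].
  apply/continuousP => V Vo.
  exact/(@open_of_rough_open _ F)/fc/rough_open_singleton.
exact/rough_open_singleton/gc/(@open_of_rough_open _ L).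
Qed.
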